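(* Let $U$ be a finite ground set with $|U|=n$, let $g:2^U\to\mathbb{R}_{\geq0}$ be nonnegative, monotone and submodular, let $c$ be a nonnegative modular cost function on $U$, and let $\tau$ be a threshold such that some $X\subseteq U$ satisfies $g(X)-c(X)\geq\tau$; let $OPT$ be a minimum-cardinality such set. Let $\gamma,\beta,\rho>0$, and suppose \texttt{reg} is an algorithm which, for every nonnegative monotone submodular function $g'$ on $U$, every nonnegative modular cost function $c'$ on $U$ and every budget $\kappa$, runs in time $T(n)$ and returns a set $S$ with $|S|\leq\rho\kappa$ and $g'(S)-c'(S)\geq\gamma g'(X)-\beta c'(X)$ for all $X\subseteq U$ with $|X|\leq\kappa$. Then for any $\alpha>0$, the algorithm \texttt{convert-reg} (described in the context) using \texttt{reg} as a subroutine runs in time $O(\log_{1+\alpha}(n)T(n))$ and returns a set $S$ with $|S|\leq(1+\alpha)\rho|OPT|$ and $g(S)-\frac{\gamma}{\beta}c(S)\geq\gamma\tau$.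
   Context: A set function $h$ is submodular if $h(A\cup\{x\})-h(A)\geq h(B\cup\{x\})-h(B)$ for $A\subseteq B\subseteq U$, $x\notin B$, and monotone if $h(A)\leq h(B)$ for $A\subseteq B$. A cost function $c$ is modular and nonnegative if there are $c_x\geq0$ ($x\in U$) with $c(X)=\sum_{x\in X}c_x$. Regularized submodular cover asks for a minimum-cardinality $X$ with $g(X)-c(X)\geq\tau$. Algorithm \texttt{convert-reg}(input $\alpha$): set $\kappa\gets1+\alpha$, $S\gets\emptyset$. While $g(S)-\frac{\gamma}{\beta}c(S)<\gamma\tau$: set $S\gets$ output of \texttt{reg} run with objective $g-\frac{\gamma}{\beta}c$ (i.e. $g'=g$, $c'=\frac{\gamma}{\beta}c$) and budget $\kappa$; then $\kappa\gets(1+\alpha)\kappa$. Return $S$. *)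

(* Defs.v *)
From HB Require Import structures.
From mathcomp Require Import all_boot all_order all_algebra.
From mathcomp Require Import all_classical all_reals all_analysis.
Import Order.TTheory GRing.Theory Num.Theory.
Import numFieldNormedType.Exports.

Set Implicit Arguments.
Unset Strict Implicit.
Unset Printing Implicit Defensive.

Local Open Scope ring_scope.

Section SetFunctions.
Variables (R : realType) (U : finType).
Implicit Types (h g c : {set U} -> R) (A B X : {set U}).

Definition submodular_fun h : Prop :=
  forall A B x, A \subset B -> x \notin B ->
    h (x |: B) - h B <= h (x |: A) - h A.

Definition monotone_fun h : Prop := forall A B, A \subset B -> h A <= h B.

Definition nonneg_fun h : Prop := forall A, 0 <= h A.

Definition nonneg_modular c : Prop :=
  exists2 w : U -> R, (forall x, 0 <= w x) &
    (forall X, c X = \sum_(x in X) w x).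

Definition reg_feasible g c (tau : R) X : Prop := tau <= g X - c X.

Definition min_reg_cover g c (tau : R) (OPT : {set U}) : Prop :=
  reg_feasible g c tau OPT /\
  (forall X, reg_feasible g c tau X -> (#|OPT| <= #|X|)%N).

End SetFunctions.

(* A deterministic algorithm for regularized submodular maximization, on any
   ground set: from the (value oracles of the) functions g', c' and a real
   budget, it computes a set together with the number of steps of the run. *)
Definition reg_algorithm (R : realType) : Type :=
  forall U : finType,
    ({set U} -> R) -> ({set U} -> R) -> R -> {set U} * nat.

(* Budgets are positive: for a negative one, |Y| <= rho * kappa is impossible.
   A run takes at least one step. *)
Definition reg_guarantee (R : realType) (gamma beta rho : R)
    (reg : reg_algorithm R) (T : nat -> R) (U : finType) : Prop :=
  forall (g' c' : {set U} -> R) (kappa : R),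
    nonneg_fun g' -> monotone_fun g' -> submodular_fun g' -> nonneg_modular c' ->
    0 < kappa ->
    let: (Y, steps) := reg U g' c' kappa in
    [/\ (0 < steps)%N, steps%:R <= T #|U|,
        #|Y|%:R <= rho * kappa &
        forall X : {set U}, #|X|%:R <= kappa ->
          gamma * g' X - beta * c' X <= g' Y - c' Y].

(* Cost, in steps, of what convert-reg executes besides reg itself: the
   initial assignments, one evaluation of the loop guard (a query to g and
   one to c), one update of kappa. A step of reg is charged slowdown_cost
   steps, as each query to (gamma / beta) c is answered by scaling one to c. *)
Record cost_model := CostModel {
  init_cost : nat;
  guard_cost : nat;
  update_cost : nat;
  slowdown_cost : nat
}.

Section ConvertReg.
Variables (R : realType) (K : cost_model) (reg : reg_algorithm R).
Variables (gamma beta alpha : R).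
Variables (U : finType) (g c : {set U} -> R) (tau : R).

Definition scaled_cost (X : {set U}) : R := gamma / beta * c X.

Definition loop_guard (S : {set U}) : bool :=
  g S - scaled_cost S < gamma * tau.

(* Big-step semantics of the while loop: convert_loop kappa S S' t means that
   the loop entered in state (kappa, S) terminates with S' after t steps. *)
Inductive convert_loop : R -> {set U} -> {set U} -> nat -> Prop :=
| ConvertLoopDone (kappa : R) (S : {set U}) :
    ~~ loop_guard S -> convert_loop kappa S S (guard_cost K)
| ConvertLoopStep (kappa : R) (S S1 S' : {set U}) (steps t : nat) :
    loop_guard S ->
    reg g scaled_cost kappa = (S1, steps) ->
    convert_loop ((1 + alpha) * kappa) S1 S' t ->
    convert_loop kappa S S'
      (guard_cost K + slowdown_cost K * steps + update_cost K + t)%N.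

Definition convert_reg (S : {set U}) (t : nat) : Prop :=
  exists2 t', convert_loop (1 + alpha) finset.set0 S t' & t = (init_cost K + t')%N.

End ConvertReg.

Definition log_base (R : realType) (b x : R) : R := ln x / ln b.

(* Main.v *)
(** Writing m = #|OPT|, the loop keeps the invariant: if the guard holds then
    kappa <= (1 + alpha) m. Indeed a run of reg with kappa >= m returns a set
    that is at least as good as gamma (g - c)(OPT) >= gamma tau, so it switches
    the guard off. The invariant bounds the size of every set returned by reg,
    and, as kappa grows geometrically, the number of iterations by
    1 + log_(1 + alpha) n. It holds initially because a true guard at the empty
    set forces OPT to be nonempty: testing reg on a constant function shows
    that gamma <= 1, so that g(empty) >= tau implies g(empty) >= gamma tau. *)
Require Import Defs.
From HB Require Import structures.
From mathcomp Require Import all_boot all_order all_algebra.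
From mathcomp Require Import all_classical all_reals all_analysis.
From mathcomp Require Import lra.
Import Order.TTheory GRing.Theory Num.Theory.
Import numFieldNormedType.Exports.
Local Open Scope classical_set_scope.
Local Open Scope ring_scope.

Lemma nonneg_modular_set0 {R : realType} {U : finType} {c : {set U} -> R} :
  nonneg_modular c -> c finset.set0 = 0.
Proof. by case=> w _ ->; rewrite big_set0. Qed.

Lemma nonneg_modularZ {R : realType} {U : finType} {c : {set U} -> R} {a : R} :
  0 <= a -> nonneg_modular c -> nonneg_modular (fun X => a * c X).
Proof.
move=> a0 [w w0 cE]; exists (fun x => a * w x) => [x|X].
  exact: mulr_ge0.
by rewrite cE mulr_sumr.
Qed.

Section Reg.
Context {R : realType} {gamma beta rho : R} {reg : reg_algorithm R}.
Context {T : nat -> R} {U : finType}.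
Hypothesis regP : reg_guarantee gamma beta rho reg T U.

(** Test with [g' = 1], [c' = 0], budget 1 and [X] empty. The bound on [T] holds since a run takes
    at least one step; it lets additive constants be absorbed into multiples of [T #|U|]. *)
Lemma reg_guarantee_const : gamma <= 1 /\ 1 <= T #|U|.
Proof.
have mod0 : nonneg_modular (fun _ : {set U} => 0 : R).
  by exists (fun=> 0) => // X; rewrite big1.
have := regP (fun=> 1) (fun=> 0) 1 (fun=> ler01) (fun _ _ _ => lexx _)
  (fun _ _ _ _ _ => lexx _) mod0 ltr01.
case: (reg _ _ _ _) => Y steps [steps_gt0 stepsT _ /(_ finset.set0)].
rewrite cards0 mulr1 mulr0 !subr0 => gamma_le1; split; first exact: gamma_le1.
by apply: le_trans stepsT; rewrite ler1n.
Qed.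

Context {alpha : R} {g c : {set U} -> R} {tau : R} {OPT : {set U}}.
Hypotheses (gamma_gt0 : 0 < gamma) (beta_gt0 : 0 < beta) (rho_gt0 : 0 < rho).
Hypothesis alpha_gt0 : 0 < alpha.
Hypotheses (g_ge0 : nonneg_fun g) (g_mono : monotone_fun g).
Hypotheses (g_submod : submodular_fun g) (c_mod : nonneg_modular c).
Hypothesis OPT_feasible : reg_feasible g c tau OPT.

Lemma loop_guard_set0 :
  loop_guard gamma beta g c tau finset.set0 -> (0 < #|OPT|)%N.
Proof.
rewrite /loop_guard /scaled_cost (nonneg_modular_set0 c_mod) mulr0 subr0 => guard0.
rewrite lt0n cards_eq0; apply/eqP => OPT0; move: OPT_feasible.
rewrite /reg_feasible OPT0 (nonneg_modular_set0 c_mod) subr0.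
move=> tau_le; move: guard0; apply/negP; rewrite -leNgt.
(* For negative [tau], [gamma <= 1] points the wrong way; there [gamma * tau <= 0] and [g] is
   nonnegative. *)
have [tau_ge0|tau_lt0] := leP 0 tau.
  by apply: le_trans tau_le; rewrite ler_piMl//; case: reg_guarantee_const.
by apply: le_trans (g_ge0 _); rewrite pmulr_rle0// ltW.
Qed.

Lemma reg_scaled_cost {kappa : R} {Y : {set U}} {steps : nat} :
  0 < kappa -> reg U g (scaled_cost gamma beta c) kappa = (Y, steps) ->
  [/\ steps%:R <= T #|U|, #|Y|%:R <= rho * kappa &
      loop_guard gamma beta g c tau Y -> kappa < #|OPT|%:R].
Proof.
move=> kappa_gt0 regE.
have := regP g (scaled_cost gamma beta c) kappa g_ge0 g_mono g_submod
  (nonneg_modularZ (ltW (divr_gt0 gamma_gt0 beta_gt0)) c_mod) kappa_gt0.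
rewrite regE => -[_ stepsT sizeY bestY]; split=> // guardY.
rewrite ltNge; apply/negP => /bestY OPT_le.
move: guardY; rewrite /loop_guard ltNge => /negP; apply.
apply: le_trans OPT_le.
(* The factor [beta] of the guarantee cancels the scaling [gamma / beta], leaving
   [gamma * (g OPT - c OPT)]. *)
rewrite /scaled_cost mulrA mulrCA divff ?gt_eqF// mulr1 -mulrBr.
by rewrite ler_pM2l.
Qed.

(** [N] bounds the iterations still to come: each multiplies [kappa] by [1 + alpha], and beyond
    [(1 + alpha) * #|OPT|] the invariant forces the guard off. The size of [S] is bounded beforehand
    because the loop may return [S] itself. Termination is the existence of a run. *)
Lemma convert_loop_correct (K : cost_model) (N : nat) (kappa : R)
    (S : {set U}) :
  0 < kappa ->
  (loop_guard gamma beta g c tau S -> kappa <= (1 + alpha) * #|OPT|%:R) ->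
  (1 + alpha) * #|OPT|%:R < (1 + alpha) ^+ N * kappa ->
  #|S|%:R <= (1 + alpha) * rho * #|OPT|%:R ->
  (exists S' t,
     convert_loop K reg gamma beta alpha g c tau kappa S S' t) /\
  (forall S' t, convert_loop K reg gamma beta alpha g c tau kappa S S' t ->
     [/\ t%:R <= (guard_cost K)%:R
           + N%:R * ((guard_cost K)%:R + (slowdown_cost K)%:R * T #|U|
                     + (update_cost K)%:R),
         #|S'|%:R <= (1 + alpha) * rho * #|OPT|%:R &
         gamma * tau <= g S' - gamma / beta * c S']).
Proof.
have [_ T_ge1] := reg_guarantee_const.
set D := (X in _ + N%:R * X).
have D_ge0 : 0 <= D by rewrite !addr_ge0// mulr_ge0// (le_trans ler01).
have doneP (M : nat) (k : R) (Y : {set U}) :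
    ~~ loop_guard gamma beta g c tau Y ->
    #|Y|%:R <= (1 + alpha) * rho * #|OPT|%:R ->
    (exists S' t,
       convert_loop K reg gamma beta alpha g c tau k Y S' t) /\
    (forall S' t, convert_loop K reg gamma beta alpha g c tau k Y S' t ->
       [/\ t%:R <= (guard_cost K)%:R + M%:R * D,
           #|S'|%:R <= (1 + alpha) * rho * #|OPT|%:R &
           gamma * tau <= g S' - gamma / beta * c S']).
  move=> guardY sizeY; split.
    by exists Y, (guard_cost K); exact: ConvertLoopDone.
  move=> S' t loop; inversion loop as [|? ? ? ? ? ? guardY']; subst.
    by split=> //; [rewrite lerDl mulr_ge0|rewrite leNgt].
  by rewrite guardY' in guardY.
elim: N kappa S => [|N IHN] kappa S kappa_gt0 kappa_le kappaN sizeS.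
  apply: doneP sizeS; apply/negP => /kappa_le; rewrite leNgt => /negP; apply.
  by rewrite expr0 mul1r in kappaN.
have [guardS|guardS] := boolP (loop_guard gamma beta g c tau S); last first.
  exact: doneP.
case regE : (reg U g (scaled_cost gamma beta c) kappa) => [Y steps].
have [stepsT sizeY guardY] := reg_scaled_cost kappa_gt0 regE.
have alpha1_gt0 : 0 < 1 + alpha by rewrite addr_gt0.
have [||||[S' [t loop]] loopP] := IHN ((1 + alpha) * kappa) Y.
- exact: mulr_gt0.
(* A true guard at [Y] means [kappa < #|OPT|], which is the invariant for the next budget. *)
- by move=> /guardY kappa_lt; rewrite ler_pM2l// ltW.
- by rewrite mulrA -exprSr.
(* This run started under a true guard, so the invariant bounds the budget it was given. *)
- apply: le_trans sizeY _; rewrite mulrAC [leRHS]mulrC ler_pM2l//.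
  exact: kappa_le.
split.
  by eexists; eexists; apply: ConvertLoopStep regE loop.
move=> S'' t'' loop''; inversion loop''
  as [? ? guardS'|? ? S1 ? steps1 ? _ regE1 loop1]; subst.
  by rewrite guardS in guardS'.
(* As [reg] is a function, every derivation passes through the same [Y]. *)
move: regE1; rewrite regE => -[? ?]; subst.
have [tle sizeS'' feasS''] := loopP _ _ loop1; split=> //.
have iter_le : (guard_cost K + slowdown_cost K * steps1 + update_cost K)%:R <= D.
  by rewrite !natrD natrM lerD2r lerD2l ler_wpM2l.
by rewrite natrD mulrSr mulrDl mul1r addrA [leLHS]addrC lerD.
Qed.
End Reg.

Lemma exp_log_base_gt {R : realType} {b : R} (n : nat) : 1 < b ->
  n%:R < b ^+ (Num.truncn (log_base b n%:R)).+1.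
Proof.
move=> b_gt1; have b_gt0 : 0 < b by rewrite (lt_trans ltr01).
(* Zero is treated apart, as its logarithm is a default value. Otherwise taking logarithms reduces
   the claim to a real being less than its truncation plus one. *)
case: n => [|n]; first exact: exprn_gt0.
rewrite -ltr_ln ?posrE ?exprn_gt0 ?ltr0Sn// lnXn// -[ltRHS]mulr_natl.
rewrite -ltr_pdivrMr ?ln_gt0//; exact: truncnS_gt.
Qed.

Lemma log_base_nat_ge0 {R : realType} {b : R} (n : nat) :
  1 < b -> 0 <= log_base b n%:R.
Proof.
move=> b_gt1; rewrite divr_ge0 ?(ln_ge0 (ltW b_gt1))//.
by case: n => [|n]; [rewrite ln0|rewrite ln_ge0 ?ler1n].
Qed.

Lemma log_base_ge1_near {R : realType} {b : R} : 1 < b ->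
  \forall n \near \oo, 1 <= log_base b n%:R.
Proof.
move=> b_gt1; have b_gt0 : 0 < b by rewrite (lt_trans ltr01).
near=> n; have b_le_n : b <= n%:R by near: n; exact: nbhs_infty_ger.
rewrite ler_pdivlMr ?ln_gt0// mul1r ler_ln// posrE.
exact: lt_le_trans b_le_n.
Unshelve. all: end_near. Qed.

Theorem theorem5 (R : realType) (K : cost_model) (gamma beta rho : R)
    (gamma_gt0 : 0 < gamma) (beta_gt0 : 0 < beta) (rho_gt0 : 0 < rho)
    (reg : reg_algorithm R) (T : nat -> R)
    (alpha : R) (alpha_gt0 : 0 < alpha) :
  exists time : nat -> R,
    time =O_\oo (fun n : nat => log_base (1 + alpha) n%:R * T n) /\
    forall (U : finType) (g c : {set U} -> R) (tau : R) (OPT : {set U}),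
      nonneg_fun g -> monotone_fun g -> submodular_fun g -> nonneg_modular c ->
      min_reg_cover g c tau OPT ->
      reg_guarantee gamma beta rho reg T U ->
      (exists (S : {set U}) (t : nat),
         convert_reg K reg gamma beta alpha g c tau S t) /\
      (forall (S : {set U}) (t : nat),
         convert_reg K reg gamma beta alpha g c tau S t ->
         [/\ t%:R <= time #|U|,
             #|S|%:R <= (1 + alpha) * rho * #|OPT|%:R &
             gamma * tau <= g S - gamma / beta * c S]).
Proof.
have b_gt1 : 1 < 1 + alpha by rewrite ltrDl.
pose iter_cost := (guard_cost K + slowdown_cost K + update_cost K)%N.
(* The final 1 keeps [C] positive even if all costs in [K] vanish. *)
pose C : R := (init_cost K)%:R + (guard_cost K)%:R + iter_cost%:R + 1.
(* The summand 1 accounts for rounding the number of iterations; the logarithm alone is 0 for a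
   one-element ground set. *)
exists (fun n => C * (1 + log_base (1 + alpha) n%:R) * T n); split.
  have C_gt0 : 0 < C by rewrite ltr_wpDl// !addr_ge0.
  (* The factor 2 comes from [1 + l <= 2 * l], valid once the logarithm [l] is at least 1. *)
  apply/eqO_exP; exists (2 * C); first exact: mulr_gt0.
  near=> n.
  have log_ge1 : 1 <= log_base (1 + alpha) n%:R.
    by near: n; exact: log_base_ge1_near.
  move: (log_base _ _) log_ge1 => l l_ge1; have l_ge0 := le_trans ler01 l_ge1.
  rewrite !normrM mulrA ler_wpM2r// (gtr0_norm C_gt0) (ger0_norm l_ge0).
  rewrite ger0_norm ?addr_ge0//.
  by rewrite [2 * C]mulrC -mulrA ler_pM2l// mulrDl mul1r lerD2r.
move=> U g c tau OPT g_ge0 g_mono g_submod c_mod [OPT_feasible _] regP.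
set N := (Num.truncn (log_base (1 + alpha) #|U|%:R : R)).+1.
have OPT_lt : #|OPT|%:R < (1 + alpha) ^+ N.
  by apply: le_lt_trans (exp_log_base_gt #|U| b_gt1); rewrite ler_nat max_card.
have [||||[S [t loop]] loopP] := convert_loop_correct regP gamma_gt0 beta_gt0
  rho_gt0 alpha_gt0 g_ge0 g_mono g_submod c_mod OPT_feasible K N (1 + alpha)
  finset.set0.
- exact: lt_trans b_gt1.
- move=> /(loop_guard_set0 regP gamma_gt0 g_ge0 c_mod OPT_feasible) OPT_gt0.
  by rewrite ler_pMr ?ler1n// (lt_trans ltr01).
(* The initial budget [1 + alpha] cancels on both sides, leaving [OPT_lt]. *)
- by rewrite mulrC ltr_pM2r// (lt_trans ltr01).
- by rewrite cards0 !mulr_ge0// ltW// (lt_trans ltr01).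
split; first by exists S; eexists; exists t.
move=> S' _ [t' loop' ->]; have [t'_le sizeS' feasS'] := loopP _ _ loop'.
split=> //; rewrite natrD.
have [_ T_ge1] := reg_guarantee_const regP.
have log_ge0 := log_base_nat_ge0 #|U| b_gt1.
have N_le : N%:R <= 1 + log_base (1 + alpha) #|U|%:R.
  by rewrite /N -nat1r lerD2l truncn_le.
move: (T #|U|) T_ge1 t'_le => x x_ge1 t'_le.
move: (1 + log_base _ _) N_le => l N_le.
have l_ge1 : 1 <= l by apply: le_trans N_le; rewrite ler1n.
have lx_ge1 : 1 <= l * x by rewrite mulr_ege1.
have const_le (k : nat) : k%:R <= k%:R * (l * x) :> R by rewrite ler_peMr.
have iter_le : (guard_cost K)%:R + (slowdown_cost K)%:R * x + (update_cost K)%:R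
    <= iter_cost%:R * x.
  by rewrite !natrD !mulrDl !lerD ?ler_peMr.
have loop_le : t'%:R <= (guard_cost K)%:R * (l * x) + iter_cost%:R * (l * x).
  apply: le_trans t'_le _; rewrite lerD ?const_le// mulrCA ler_pM//.
  by rewrite !addr_ge0// mulr_ge0// (le_trans ler01).
rewrite /C -mulrA; move: (const_le (init_cost K)) loop_le lx_ge1.
lra.
Unshelve. all: end_near. Qed.
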